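(* Assume the following conditions (Z1)–(Z5) and (G7), in the framework and notation of the context. (Z1) $r:\Theta\to(0,\infty)$, $\theta\mapsto r_\theta$, is a positive measurable function, $\overline r$ is a positive number, $\Theta_0=\{\theta\in\Theta: r_\theta>\overline r\}$, and $\overline r$ is such that $\mathrm{Var}_\theta Y>0$ for all $\theta\in\Theta_0$. (Z2) Let $\mu_\theta=\mathbb{E}_\theta Y$, $\sigma_\theta^2=\mathrm{Var}_\theta Y$, and let $W=(Y-\mu_\theta)/\sigma_\theta$ whenever $\sigma_\theta>0$ and $W=0$ otherwise. $W^*$ is a random variable such that for each $\theta\in\Theta_0$, $W^*$ has the $W$-zero bias distribution with respect to $\mathbb{P}_\theta$. (Z3) For each $\theta\in\Theta_0$, $\mathcal{F}_\theta\subset\mathcal{F}$ is a sub-$\sigma$-algebra. Let $D=W^*-W$. $\overline D$ is a random variable such that, for each $\theta\in\Theta_0$, $\overline D(\theta,\cdot)$ is $\mathcal{F}_\theta$-measurable, and $F_{\theta,1}$ is an event (which need not be in $\mathcal{F}_\theta$) on which $|D|\le\overline D$ and such that $$\sup_{\theta\in\Theta_0} r_\theta^2\,\mathbb{E}_\theta\{|D|(1-I_{F_{\theta,1}})\}<\infty\quad\text{and}\quad\sup_{\theta\in\Theta_0} r_\theta\,\mathbb{E}_\theta\{|DW|+\overline D\}<\infty .$$ (Z4) $V$ is a random variable and $\Psi$ is a $\Theta$-valued random element such that, for each $\theta\in\Theta_0$, $\Psi(\theta,\cdot)$ is $\mathcal{F}_\theta$-measurable. For each $\theta\in\Theta_0$,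 $F_{\theta,2}\in\mathcal{F}_\theta$ is an event such that $$\mathbb{P}_\theta[V\in\cdot\mid\mathcal{F}_\theta](\omega)=\mathbb{P}_{\Psi(\theta,\omega)}[Y\in\cdot\,]\quad\text{for all }\omega\in F_{\theta,2},$$ and $$\sup_{\theta\in\Theta_0} r_\theta^2\,\mathbb{E}_\theta\{|D|(1-I_{F_{\theta,2}})\}<\infty .$$ (Z5) $\overline B$ is a random variable such that, for each $\theta\in\Theta_0$, $\overline B(\theta,\cdot)$ is $\mathcal{F}_\theta$-measurable, and $$\sigma_\theta^{-1}|Y-V|\le\overline B\ \text{ on }F_{\theta,1},\quad\text{and}\quad\sup_{\theta\in\Theta_0} r_\theta^2\,\mathbb{E}_\theta\{\overline D(\overline B+\overline D)I_{F_{\theta,2}}\}<\infty .$$ (G7) With essential suprema taken with respect to $\mathbb{P}_\theta$, $$\sup_{\theta\in\Theta_0}\ \operatorname*{ess\,sup}_{\omega\in F_{\theta,2}\cap\{\Psi(\theta,\cdot)\in\Theta_0\}}\frac{\sigma_\theta^2}{\sigma_{\Psi(\theta,\omega)}^2}<\infty,\qquad \sup_{\theta\in\Theta_0}\ \operatorname*{ess\,sup}_{\omega\in F_{\theta,2}}\frac{r_\theta}{r_{\Psi(\theta,\omega)}}<\infty,\qquad \sup_{\theta\in\Theta_0}\ \operatorname*{ess\,sup}_{\omega\in F_{\theta,2}\cap\{\Psi(\theta,\cdot)\in\Theta_0\}}\frac{r_{\Psi(\theta,\omega)}}{r_\theta}<\infty .$$ Then there exists a constant $C$, independent of $\theta$,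 such that $$\sup_{z\in\mathbb{R}}\big|\mathbb{P}_\theta[W\le z]-\mathbb{P}[Z\le z]\big|\le\frac{C}{r_\theta}\qquad\text{for all }\theta\in\Theta,$$ where $Z$ is a standard normal random variable.
   Context: Framework. $(\Theta,\mathcal{T})$ (parameter space) and $(\Omega,\mathcal{F})$ (sample space) are measurable spaces. All random variables are real-valued measurable functions on the product space $(\Theta\times\Omega,\mathcal{T}\otimes\mathcal{F})$; a $\Theta$-valued random element is a measurable map $\Theta\times\Omega\to\Theta$. A transition kernel $\theta\mapsto\mathbb{P}_\theta$ from $\Theta$ to $\Omega$ is given: for each $\theta\in\Theta$, $\mathbb{P}_\theta$ is a probability measure on $(\Omega,\mathcal{F})$, and for each $A\in\mathcal{F}$ the map $\theta\mapsto\mathbb{P}_\theta[A]$ is $\mathcal{T}$-measurable. For a random variable $X$, $\mathbb{E}_\theta X=\int_\Omega X(\theta,\omega)\,\mathbb{P}_\theta[d\omega]$, and its distribution under $\mathbb{P}_\theta$ is that of $X(\theta,\cdot)$; $\mathrm{Var}_\theta$ and conditional expectations are likewise with respect to $\mathbb{P}_\theta$. In particular $\mathbb{P}_{\theta'}[Y\in\cdot\,]$ is the law of $Y(\theta',\cdot)$ under $\mathbb{P}_{\theta'}$. Events such as $F_{\theta,1}$ are elements of $\mathcal{F}$, and $I_F$ is the indicator of $F$. $Y$ is the (unstandardized) random variable of interest, with finite mean and variance under each $\mathbb{P}_\theta$. Zero bias distribution: for a random variable $W$ with mean zero and variance $\sigma^2\in(0,\infty)$, $W^*$ has the $W$-zero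 bias distribution if $\mathbb{E}\{Wf(W)\}=\sigma^2\,\mathbb{E}\{f'(W^* )\}$ for all (locally absolutely continuous) functions $f$ for which these expectations exist.
   Formalization: The formal theorem additionally assumes that the bounds D̄(θ,·) and B̄(θ,·) are nonnegative for every θ in Θ₀; if they may take negative values off F_{θ,1}, the one-sided conditions sup < ∞ in (Z3) and (Z5) lose their force and the claim fails. *)

(* Defs.v *)
From HB Require Import structures.
From mathcomp Require Import all_boot all_order all_algebra.
From mathcomp Require Import all_classical all_reals all_analysis.
From mathcomp Require Import measurable_realfun ess_sup_inf normal_distribution.
Set Implicit Arguments.
Unset Strict Implicit.
Unset Printing Implicit Defensive.
Import Order.TTheory GRing.Theory Num.Theory.
Import numFieldNormedType.Exports.
Local Open Scope classical_set_scope.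
Local Open Scope ring_scope.

(* [x i, y i] and [x j, y j] may touch but do not overlap when i != j. *)
Definition locally_abs_continuous (R : realType) (f : R -> R) : Prop :=
  forall a b e : R, 0 < e -> exists2 delta : R, 0 < delta &
    forall (n : nat) (x y : 'I_n -> R),
      (forall i, [/\ a <= x i, x i <= y i & y i <= b]) ->
      (forall i j, i != j -> y i <= x j \/ y j <= x i) ->
      \sum_(i < n) (y i - x i) < delta ->
      \sum_(i < n) `|f (y i) - f (x i)| < e.

(* A locally absolutely continuous f is differentiable only almost everywhere,
   so f' ranges over the Borel functions equal to the derivative of f at almost
   every point. The two expectations are said to exist when the integrands are
   integrable. *)
Definition zero_bias d (T : measurableType d) (R : realType)
    (P : probability T R) (W Wstar : T -> R) : Prop :=
  forall f f' : R -> R,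
    locally_abs_continuous f ->
    measurable_fun [set: R] f' ->
    {ae lebesgue_measure, forall x : R, is_derive x 1 f (f' x)} ->
    P.-integrable [set: T] (fun w => (W w * f (W w))%:E) ->
    P.-integrable [set: T] (fun w => (f' (Wstar w))%:E) ->
    ('E_P[fun w => (W w * f (W w))%R] =
       'V_P[W] * 'E_P[fun w => f' (Wstar w)])%E.

Definition is_sub_sigma_algebra d (T : measurableType d) (G : set_system T) :
    Prop :=
  sigma_algebra [set: T] G /\ G `<=` measurable.

Definition measurable_wrt (T : Type) (G : set_system T) d'
    (T' : measurableType d') (f : T -> T') : Prop :=
  forall B : set T', measurable B -> G (f @^-1` B).

(* k is a regular version of the conditional distribution P[X \in . | G]. *)
Definition is_cond_distribution d (T : measurableType d) (R : realType)
    (P : probability T R) (G : set_system T) (X : T -> R)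
    (k : T -> probability R R) : Prop :=
  forall B : set R, measurable B ->
    measurable_wrt (T' := \bar R) G (fun w => k w B) /\
    forall A : set T, G A ->
      (\int[P]_(w in A) k w B = P (A `&` X @^-1` B))%E.

(* The value -oo outside A makes points of A alone matter; in particular the
   essential supremum over a negligible set is -oo. *)
Definition ess_sup_on d (T : measurableType d) (R : realType)
    (P : probability T R) (A : set T) (f : T -> R) : \bar R :=
  ess_sup P (fun w => if w \in A then (f w)%:E else -oo%E).

Section family.
Context d1 d2 (Theta : measurableType d1) (Omega : measurableType d2)
  (R : realType).
Variables (P : Theta -> probability Omega R) (Y : Theta * Omega -> R).

Definition pmean (t : Theta) : R := fine 'E_(P t)[fun w => Y (t, w)].

Definition pvar (t : Theta) : R := fine 'V_(P t)[fun w => Y (t, w)].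

Definition psd (t : Theta) : R := Num.sqrt (pvar t).

Definition standardized (p : Theta * Omega) : R :=
  if 0 < psd p.1 then (Y p - pmean p.1) / psd p.1 else 0.

End family.

(* Main.v *)
Require Import Defs.
From HB Require Import structures.
From mathcomp Require Import all_boot all_order all_algebra.
From mathcomp Require Import all_classical all_reals all_analysis.
From mathcomp Require Import measurable_realfun ess_sup_inf normal_distribution.
From mathcomp Require Import ring lra.
Set Implicit Arguments.
Unset Strict Implicit.
Unset Printing Implicit Defensive.
Import Order.TTheory GRing.Theory Num.Theory.
Import numFieldNormedType.Exports.
Local Open Scope classical_set_scope.
Local Open Scope ring_scope.

(** Write [Delta t z] for the discrepancy at [z] between the distribution
    function of [W] under [P t] and that of the standard normal law. Outside
    [Theta0] one has [r t <= rbar], and [Delta <= 1] settles the matter. On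
    [Theta0] Stein's method bounds the discrepancy at [t], up to a term of
    order 1/r, by a small multiple of that at the parameters [Psi (t, w)],
    and a contraction argument closes the loop.

    Stein's method. Replace the indicator of a half-line by a ramp [h] of
    width [e], at the cost of [e] ([kolmogorov_smoothing]). The solution [f]
    of [f' x - x * f x = h x - E h(Z)] satisfies [f] bounded and [|f'| <= 2]
    (section [stein_equation]). As [Var W = 1], the zero bias identity is
    [E(W f(W)) = E f'(Wstar)], so [E h(W) - E h(Z) = E(f'(W) - f'(Wstar))].
    By the Stein equation [f'(Wstar) - f'(W)] is a term of order
    [|D| + |D W|], whose expectation is O(1/r), plus [h(Wstar) - h(W)]
    ([zero_bias_stein_bound]).

    The ramp term. [h(Wstar) - h(W)] is at most [|D| / e], and vanishes
    unless [W] is within [|D|] of an interval of length [e]. Off [F1] or off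
    [F2] the bound [|D| / e] is good enough. On [F1] and [F2] it is at most
    [Dbar / e] on the event that the standardized [V] is within [Dbar + Bbar]
    of that interval, and now everything but [V] is measurable with respect
    to the conditioning sigma-algebra. Given it, [V] has the law of [Y] under
    [P u], [u = Psi (t, w)], and for [u] in [Theta0] this law puts on an
    interval of length [l] a mass of at most
    [l / sigma_u + 2 * sup_z Delta u z] ([le_prob_itv]). Integrating
    ([le_integral_window]) gives [one_step].

    The contraction. For fixed [n] let [S] be the supremum of
    [min (r t) n * Delta t z] over [Theta0]; it is at most [n]. If [u] is in
    [Theta0] then [Delta u z <= S / min (r u) n <= Kb * S / min (r t) n],
    because [r t <= Kb * r u] almost surely; if not, then [r t <= Kb * rbar]
    and the trivial bound 1 is of order 1/r. With [e = L / r t] and [L]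
    large, [one_step] becomes [S <= C + S / 2] with [C] independent of [n],
    hence [S <= 2 * C], and [n = r t] gives the theorem. The truncation by
    [n] is what makes [S] finite a priori. *)

(** * The standard normal density *)

Section standard_normal_density.
Context {R : realType}.
Local Notation phi := (@normal_pdf R 0 1).

Lemma std_normal_pdfE x : phi x = normal_peak 1 * expR (- (x ^+ 2 / 2)).
Proof.
rewrite (normal_pdfE 0 (oner_neq0 R)) /normal_fun subr0 expr1n.
by rewrite mulNr.
Qed.

Lemma std_normal_pdf_gt0 x : 0 < phi x.
Proof.
by rewrite std_normal_pdfE mulr_gt0 ?expR_gt0 ?normal_peak_gt0 ?oner_neq0.
Qed.

Lemma std_normal_pdf_even x : phi (- x) = phi x.
Proof. by rewrite !std_normal_pdfE sqrrN. Qed.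

Lemma std_normal_pdf_le1 x : phi x <= 1.
Proof.
apply: le_trans (normal_pdf_ub 0 x (oner_neq0 R)) _.
rewrite /normal_peak expr1n mul1r invf_le1 ?sqrtr_gt0.
  rewrite -[leLHS]sqrtr1 ler_wsqrtr// mulr2n.
  by have := @pi_ge2 R; lra.
by rewrite pmulrn_lgt0// pi_gt0.
Qed.

Lemma std_normal_pdf_ge1 x : `|x| <= 1 -> phi 1 <= phi x.
Proof.
move=> x1; rewrite !std_normal_pdfE ler_pM2l ?normal_peak_gt0 ?oner_neq0//.
rewrite ler_expR lerN2 ler_pM2r ?invr_gt0// expr1n.
by rewrite -real_normK ?num_real// expr_le1.
Qed.

Lemma is_derive_std_normal_pdf (x : R) : is_derive x 1 phi (- x * phi x).
Proof.
have -> : phi =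
    (normal_peak 1) \*: (expR \o (fun y : R => - (2^-1) * (y ^+ 2))).
  apply/funext => y; rewrite std_normal_pdfE /=; congr (_ * expR _).
  by rewrite mulNr mulrC.
apply: is_derive_eq.
rewrite /= /GRing.scale /=; lra.
Qed.

End standard_normal_density.

Section mills_ratio.
Context {R : realType}.
Local Notation phi := (@normal_pdf R 0 1).
Implicit Types G g : R -> R.

(** Differentiating [phi x / - x - G x] gives [phi x * (1 + x ^- 2) - g x >= 0]
    on the negative half-line, and the difference is asymptotically
    nonnegative at -oo. With [g = phi] this is the Mills ratio bound on the
    Gaussian tail; phrasing it for a primitive [G] lets it apply directly to the
    numerator of the Stein solution. *)
Lemma mills_ub_one_sided G g (w : R) :
    (forall x : R, is_derive x 1 G (g x)) -> (forall x, g x <= phi x) ->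
    G x @[x --> -oo] --> (0 : R) -> w < 0 ->
  G w <= phi w / - w.
Proof.
move=> dG gphi G0 w0.
pose M (x : R) := phi x * (- x)^-1 - G x.
have dM (x : R) : x != 0 -> is_derive x 1 M (phi x * (1 + x ^- 2) - g x).
  move=> x0; rewrite /M.
  have dphi := is_derive_std_normal_pdf x.
  have dV : is_derive x 1 (fun y : R => (- y)^-1) (x ^- 2).
    have nx0 : - x != 0 by rewrite oppr_eq0.
    have dN : is_derive x 1 (fun y : R => - y) (- 1).
      exact: (@is_deriveN _ _ _ id x 1 1).
    apply: is_derive_eq (is_deriveV nx0 dN) _.
    by rewrite sqrrN /GRing.scale /= mulrN1 opprK.
  apply: is_derive_eq.
  by rewrite /GRing.scale /=; field.
have Mmono s : s <= w -> - G s <= M w.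
  move=> sw; apply: (@le_trans _ _ (M s)).
    rewrite /M lerDr divr_ge0 ?ltW ?std_normal_pdf_gt0 ?oppr_gt0//.
    exact: le_lt_trans w0.
  have neg x : x \in `]-oo, w] -> x != 0.
    by rewrite in_itv/= => xw; rewrite lt_eqF// (le_lt_trans xw).
  apply: (@ger0_derive1_ndecrNy _ M w) => //.
  - move=> x; rewrite in_itv/= => xw.
    by have [] := dM x (neg _ _); rewrite ?in_itv/= ?ltW.
  - move=> x; rewrite in_itv/= => xw.
    have x0 : x != 0 by rewrite neg// in_itv/= ltW.
    have dMx := dM x x0; rewrite derive1E derive_val subr_ge0.
    rewrite (le_trans (gphi x))// ler_peMr ?ltW ?std_normal_pdf_gt0//.
    by rewrite ltrDl invr_gt0 exprn_even_gt0.
  - apply: derivable_within_continuous => x xw.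
    by have [] := dM x (neg _ xw).
apply/ler_addgt0Pr => e e0.
have [s [sw Gs]] : exists s, s <= w /\ `|G s| < e.
  apply: (@filter_ex _ (-oo)); apply: filterI.
    by apply: nbhs_ninfty_le; rewrite num_real.
  exact: (cvgr0_norm_lt _ G0).
have := Mmono _ sw; rewrite /M => h.
have : - e < - G s by rewrite ltrN2 (le_lt_trans (ler_norm _)).
by move: h; set a := phi w / _; lra.
Unshelve. all: by end_near.
Qed.

Lemma mills_ub G g (w : R) :
    (forall x : R, is_derive x 1 G (g x)) -> (forall x, `|g x| <= phi x) ->
    G x @[x --> -oo] --> (0 : R) -> w < 0 ->
  `|G w| <= phi w / - w.
Proof.
move=> dG gphi G0 w0; rewrite ler_norml lerNl.
apply/andP; split; last first.
  by apply: (mills_ub_one_sided dG) => // x; rewrite (le_trans (ler_norm _)).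
apply: (@mills_ub_one_sided (- G) (fun x => - g x)) => //.
- by move=> x; rewrite (le_trans (ler_norm _))// normrN.
- by rewrite -[0]oppr0; exact: cvgN.
Qed.

End mills_ratio.

(** * The Stein equation *)

Section stein_equation.
Context {R : realType}.
Local Notation phi := (@normal_pdf R 0 1).
Local Notation mu := (@lebesgue_measure R).

Definition gaussian_mean (h : R -> R) : R := \int[mu]_x (h x * phi x).

Variable h : R -> R.
Hypotheses (ch : continuous h) (h01 : forall x, 0 <= h x <= 1).
Local Notation Nh := (gaussian_mean h).

Let mh : measurable_fun [set: R] h.
Proof. exact: continuous_measurable_fun. Qed.

Let mphi : measurable_fun [set: R] phi.
Proof. exact: measurable_normal_pdf. Qed.

Let iphi : mu.-integrable [set: R] (EFin \o phi).
Proof. exact: integrable_normal_pdf. Qed.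

Lemma integrable_mul_std_normal_pdf (g : R -> R) :
  measurable_fun [set: R] g -> (forall x, `|g x| <= 1) ->
  mu.-integrable [set: R] (EFin \o (g \* phi)).
Proof.
move=> mg g1; apply: (le_integrable measurableT) iphi.
  by apply/measurable_EFinP; exact: measurable_funM.
move=> x _ /=; rewrite lee_fin normrM ler_piMl//.
Qed.

Let ihphi : mu.-integrable [set: R] (EFin \o (h \* phi)).
Proof.
apply: integrable_mul_std_normal_pdf => // x.
by have /andP[? ?] := h01 x; rewrite ger0_norm.
Qed.

Lemma gaussian_mean01 : 0 <= Nh <= 1.
Proof.
have Tphi : \int[mu]_x phi x = 1.
  by rewrite /Rintegral integral_normal_pdf.
apply/andP; split.
  apply: Rintegral_ge0 => // x _.
  by have /andP[? ?] := h01 x; rewrite mulr_ge0// normal_pdf_ge0.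
rewrite -[leRHS]Tphi; apply: le_Rintegral => // x _.
by have /andP[? ?] := h01 x; rewrite ler_piMl// normal_pdf_ge0.
Qed.

Let u x := (h x - Nh) * phi x.

Let hN1 x : `|h x - Nh| <= 1.
Proof.
have /andP[? ?] := h01 x; have /andP[? ?] := gaussian_mean01.
by rewrite ler_norml; lra.
Qed.

Let iu : mu.-integrable [set: R] (EFin \o u).
Proof.
apply: (integrable_mul_std_normal_pdf (g := fun x => h x - Nh)) => //.
exact: measurable_funB.
Qed.

Let uphi x : `|u x| <= phi x.
Proof.
by rewrite normrM (ger0_norm (normal_pdf_ge0 _ _ _)) ler_piMl ?normal_pdf_ge0.
Qed.

Let iuS A : measurable A -> mu.-integrable A (EFin \o u).
Proof. by move=> mA; apply: integrableS iu. Qed.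

Let le_norm_Rintegral_normal_prob A : measurable A ->
  `|\int[mu]_(t in A) u t| <= fine (normal_prob 0 1 A).
Proof.
move=> mA; apply: le_trans (le_normr_Rintegral mA (iuS mA)) _.
apply: le_Rintegral => //.
- by apply/integrable_norm/iuS.
- exact: integrableS iphi.
Qed.

Let Rint_u0 : \int[mu]_t u t = 0.
Proof.
have -> : u = (h \* phi) \- (fun x => Nh * phi x).
  by apply/funext => x; rewrite /u mulrBl.
have iN : mu.-integrable [set: R] (EFin \o (fun x => Nh * phi x)).
  apply: (@integrable_mul_std_normal_pdf (cst Nh)) => //= x.
  by have /andP[? ?] := gaussian_mean01; rewrite ger0_norm.
rewrite RintegralB//= RintegralZl// [X in _ - _ * X](_ : _ = 1) ?mulr1 ?subrr//.
by rewrite /Rintegral integral_normal_pdf.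
Qed.

Let G w := \int[mu]_(t in `]-oo, w]) u t.

Let dG (x : R) : is_derive x 1 G (u x).
Proof.
have x1 : x < x + 1 by rewrite ltrDl.
have cu : {for x, continuous u}.
  apply: continuousM; last exact: (@continuous_normal_pdf R 0 1 (oner_neq0 R)).
  by apply: continuousB; [exact: ch|exact: cst_continuous].
have mI : measurable [set` Interval -oo%O (BRight (x + 1))] by [].
have [|d <-] := @continuous_FTC1 R u -oo%O x _ x1 (iuS mI) _ cu.
  by rewrite ltNyr.
rewrite derive1E.
exact: DeriveDef.
Qed.

(* The total integral of [u] vanishes, so [G] is also a right tail; this is
   what makes it decay at +oo. *)
Let G_right w : G w = - \int[mu]_(t in `]w, +oo[) u t.
Proof.
apply/eqP; rewrite -addr_eq0 -Rintegral_setU//=.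
- by rewrite itv_setU_setT Rint_u0.
- by rewrite itv_setU_setT; exact: iu.
- exact: disjoint_rays.
Qed.

Let idR : measurableTypeR R -> R := idfun.

#[local] HB.instance Definition _ :=
  @isMeasurableFun.Build _ _ _ _ idR (@measurable_id _ _ setT).

Let cvg0_dominated (g b : R -> R) : (forall x, `|g x| <= b x) ->
  b x @[x --> -oo] --> (0 : R) -> g x @[x --> -oo] --> (0 : R).
Proof.
move=> gb b0; apply/norm_cvg0P; apply: squeeze_cvgr (@cvg_cst _ 0 _ _ _) b0.
by apply: nearW => x; rewrite normr_ge0 gb.
Qed.

Let G_cvgNy : G x @[x --> -oo] --> (0 : R).
Proof.
have /fine_cvg := cvg_cdfNy0 (idR : {RV (@normal_prob R 0 1) >-> R}).
apply: cvg0_dominated => x /=; exact: le_norm_Rintegral_normal_prob.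
Qed.

Let G_cvgy : G (- x) @[x --> -oo] --> (0 : R).
Proof.
have /fine_cvg := cvg_ccdfy0 (idR : {RV (@normal_prob R 0 1) >-> R}).
move=> /cvgy_compNP.
apply: cvg0_dominated => x /=; rewrite G_right normrN.
exact: le_norm_Rintegral_normal_prob.
Qed.

Definition stein_sol w := G w / phi w.
Local Notation f := stein_sol.

Lemma is_derive_stein_sol (x : R) : is_derive x 1 f (x * f x + (h x - Nh)).
Proof.
have p0 := std_normal_pdf_gt0 x.
have dp := is_derive_std_normal_pdf x.
have dV := is_deriveV (lt0r_neq0 p0) dp.
have dGx := dG x.
change (is_derive x 1 (G * (fun y => (phi y)^-1))
                  (x * (G x / phi x) + (h x - Nh))).
apply: is_derive_eq.
by rewrite /u/GRing.scale/=; field; rewrite gt_eqF.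
Qed.

(** For [x < 0] this is the Mills ratio bound for [G]; for [x > 0] it is the
    same bound for [G] reflected, the density being even. *)
Lemma stein_sol_mul_le1 (x : R) : `|x * f x| <= 1.
Proof.
have p0 := std_normal_pdf_gt0 x.
have [->|x0] := eqVneq x 0; first by rewrite mul0r normr0.
rewrite normrM /f normrM normfV (gtr0_norm p0) mulrA ler_pdivrMr// mul1r.
rewrite mulrC -ler_pdivlMr ?normr_gt0//.
case: (ltgtP x 0) x0 => // x0 _.
  rewrite (ltr0_norm x0); exact: (mills_ub dG).
rewrite (gtr0_norm x0).
have := @mills_ub _ (fun y => G (- y)) (fun y => u (- y) * -1) (- x).
rewrite opprK std_normal_pdf_even; apply => //.
- move=> y; have dGy := dG (- y).
  exact: (@is_derive1_comp R G (fun z => - z) y (u (- y)) (-1)).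
- by move=> y; rewrite mulrN1 normrN (le_trans (uphi _))// std_normal_pdf_even.
- by rewrite oppr_lt0.
Qed.

(** Outside [[-1, 1]] the bound follows from that on [x * f x]; inside, the
    numerator is at most 1 and the density at least [phi 1]. *)
Lemma stein_sol_le (x : R) : `|f x| <= 1 + (phi 1)^-1.
Proof.
have p0 := std_normal_pdf_gt0 x; have p1 := @std_normal_pdf_gt0 R 1.
have p1V : 0 < (phi 1)^-1 by rewrite invr_gt0.
have [x1|x1] := leP 1 `|x|.
  suff : `|f x| <= 1 by move=> ?; lra.
  by apply: le_trans (stein_sol_mul_le1 x); rewrite [leRHS]normrM ler_peMl.
suff : `|f x| <= (phi 1)^-1 by move=> ?; lra.
rewrite /f normrM normfV (gtr0_norm p0) ler_pdivrMr//.
apply: (@le_trans _ _ 1).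
  apply: le_trans (le_norm_Rintegral_normal_prob _) _ => //.
  rewrite -lee_fin fineK ?fin_num_measure//; exact: probability_le1.
by rewrite ler_pdivlMl// mulr1 std_normal_pdf_ge1// ltW.
Qed.

End stein_equation.

(** * Smoothing of the Kolmogorov distance *)

Lemma integrable_of_bounded d {T : measurableType d} {R : realType}
    (P : probability T R) (c : R) (f : T -> R) :
  measurable_fun [set: T] f -> (forall x, `|f x| <= c) ->
  P.-integrable [set: T] (EFin \o f).
Proof.
move=> mf fc.
apply: (le_integrable measurableT (g := EFin \o cst c)) => //=.
- exact/measurable_EFinP.
- by move=> x _; rewrite lee_fin (le_trans (fc x)) ?ler_norm.
- exact: finite_measure_integrable_cst.
Qed.

Section ramp.
Context {R : realType}.
Implicit Types z e x y : R.

Definition ramp z e x : R := Num.max 0 (Num.min 1 ((z + e - x) / e)).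

Lemma ramp01 z e x : 0 <= ramp z e x <= 1.
Proof. by rewrite /ramp le_max lexx/= ge_max ler01/= ge_min lexx. Qed.

Lemma continuous_ramp z e : continuous (ramp z e).
Proof.
move=> x.
change {for x, continuous (cst 0 \max (cst 1 \min (fun y => (z + e - y) / e)))}.
apply: continuous_max; first exact: cst_continuous.
apply: continuous_min; first exact: cst_continuous.
apply: continuousM; last exact: cst_continuous.
by apply: continuousB; [exact: cst_continuous|exact: cvg_id].
Qed.

Lemma ramp_eq1 z e x : 0 < e -> x <= z -> ramp z e x = 1.
Proof.
move=> e0 xz; rewrite /ramp min_l ?max_r//.
by rewrite ler_pdivlMr//; lra.
Qed.

Lemma ramp_eq0 z e x : 0 < e -> z + e <= x -> ramp z e x = 0.
Proof.
move=> e0 zx; rewrite /ramp max_l// ge_min; apply/orP; right.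
by rewrite ler_pdivrMr//; lra.
Qed.

Lemma ramp_lipschitz z e x y : 0 < e ->
  `|ramp z e y - ramp z e x| <= e^-1 * `|y - x|.
Proof.
move=> e0; have -> : e^-1 * `|y - x| = `|(z + e - y) / e - (z + e - x) / e|.
  have -> : (z + e - y) / e - (z + e - x) / e = (x - y) / e by ring.
  by rewrite normrM normfV (gtr0_norm e0) mulrC distrC.
rewrite /ramp; set a := _ / e; set b := _ / e.
have := ler_norm (a - b); have := ler_norm (b - a).
rewrite [`|b - a|]distrC ler_norml !maxEle !minEle.
by do ![case: ifPn]; rewrite -?ltNge; lra.
Qed.

(** Both points lie on the same flat part unless [x] is within [|y - x|] of the
    sloping part. *)
Lemma ramp_variation z e x y : 0 < e ->
  `|ramp z e y - ramp z e x| <=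
  e^-1 * (`|y - x| * (z - `|y - x| <= x <= z + e + `|y - x|)%R%:R).
Proof.
move=> e0; have [_|] := boolP (_ && _); first by rewrite mulr1 ramp_lipschitz.
rewrite negb_and -!ltNge !mulr0 => /orP[xz|xz].
  rewrite !ramp_eq1 ?subrr ?normr0//.
    by have := normr_ge0 (y - x); lra.
  by have := ler_norm (y - x); lra.
rewrite !ramp_eq0 ?subrr ?normr0//.
  by have := normr_ge0 (y - x); lra.
by have := ler_norm (x - y); rewrite distrC; lra.
Qed.

End ramp.

Section smoothing.
Context {R : realType}.
Local Notation phi := (@normal_pdf R 0 1).
Local Notation mu := (@lebesgue_measure R).

Definition std_normal_cdf (z : R) : R := fine (normal_prob 0 1 `]-oo, z]).
Local Notation Phi := std_normal_cdf.

Let iphi : mu.-integrable [set: R] (EFin \o phi).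
Proof. exact: integrable_normal_pdf. Qed.

Lemma std_normal_cdf_lipschitz (a b : R) : a <= b -> Phi b - Phi a <= b - a.
Proof.
move=> ab; rewrite /Phi /normal_prob.
have -> : `]-oo, b]%classic = `]-oo, a] `|` `]a, b] :> set R.
  by rewrite -itv_bndbnd_setU//= bnd_simp.
rewrite -![fine _]/(Rintegral _ _ _).
rewrite Rintegral_setU//; last 2 first.
- by apply: integrableS iphi => //; exact: measurableU.
- apply: lt_disjoint => x y; rewrite !in_itv/= => xa /andP[ay _].
  exact: le_lt_trans ay.
rewrite addrAC subrr add0r.
have -> : b - a = \int[mu]_(x in `]a, b]) (cst 1) x.
  rewrite Rintegral_cst// mul1r/= lebesgue_measure_itv/= lte_fin.
  by case: ltgtP ab => //= ->; rewrite ?subrr.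
apply: le_Rintegral => //.
- exact: integrableS iphi.
- have iab : mu.-integrable `[a, b] (EFin \o cst 1).
    apply: continuous_compact_integrable; first exact: segment_compact.
    by apply: continuous_subspaceT; exact: cst_continuous.
  apply: integrableS iab => //.
  by apply: subset_itv; rewrite bnd_simp.
- by move=> x _; exact: std_normal_pdf_le1.
Qed.

Lemma le_gaussian_mean_ramp z e : 0 < e ->
  Phi z <= gaussian_mean (ramp z e) <= Phi (z + e).
Proof.
move=> e0; rewrite /Phi /normal_prob -![fine _]/(Rintegral _ _ _).
have iS (A : set (measurableTypeR R)) : measurable A ->
    mu.-integrable [set: R] (EFin \o (phi \_ A)).
  move=> mA; rewrite -restrict_EFin; apply: (integrable_mkcond _ mA).1.
  exact: integrableS iphi.
have ir : mu.-integrable [set: R] (EFin \o (ramp z e \* phi)).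
  apply: integrable_mul_std_normal_pdf.
    by apply: continuous_measurable_fun; exact: continuous_ramp.
  by move=> x; have /andP[? ?] := ramp01 z e x; rewrite ger0_norm.
rewrite /gaussian_mean ![\int[mu]_(x in `]-oo, _]) _]Rintegral_mkcond.
apply/andP; split; apply: le_Rintegral => //; try exact: iS.
  move=> x _; rewrite patchE; case: ifPn;
    rewrite ?notin_setE ?in_setE/= in_itv/=.
    by move=> xz; rewrite ramp_eq1// mul1r.
  by have /andP[? ?] := ramp01 z e x; rewrite mulr_ge0 ?normal_pdf_ge0.
move=> x _; rewrite patchE; case: ifPn; rewrite ?notin_setE ?in_setE/= in_itv/=.
  by have /andP[? ?] := ramp01 z e x; rewrite ler_piMl ?normal_pdf_ge0.
by move/negP; rewrite -ltNge => /ltW xz; rewrite ramp_eq0// mul0r.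
Qed.

Context d {T : measurableType d} (P : probability T R) (W : T -> R).
Hypothesis mW : measurable_fun [set: T] W.

Lemma cdf_ramp z e : 0 < e ->
  fine (P [set w | W w <= z]) <= \int[P]_w ramp z e (W w)
    <= fine (P [set w | W w <= z + e]).
Proof.
move=> e0.
have mS a : measurable [set w | W w <= a].
  have := mW measurableT (measurable_itv `]-oo, a]).
  by rewrite setTI preimage_itvNyc.
have PE a : fine (P [set w | W w <= a]) = \int[P]_w \1_[set w | W w <= a] w.
  by rewrite /Rintegral integral_indic// setIT.
have iI a : P.-integrable [set: T] (EFin \o \1_[set w | W w <= a]).
  exact: integrable_indic.
have ir : P.-integrable [set: T] (EFin \o (ramp z e \o W)).
  apply: (@integrable_of_bounded _ _ _ _ 1).
    apply: measurableT_comp mW.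
    by apply: continuous_measurable_fun; exact: continuous_ramp.
  by move=> x; have /andP[? ?] := ramp01 z e (W x); rewrite /= ger0_norm.
rewrite !PE; apply/andP; split; apply: le_Rintegral => //.
  move=> x _; rewrite indicE; case: (boolP (x \in _)); rewrite ?in_setE/=.
    by move=> xz; rewrite ramp_eq1.
  by have /andP[] := ramp01 z e (W x).
move=> x _; rewrite indicE; case: (boolP (x \in _)); rewrite ?notin_setE/=.
  by have /andP[] := ramp01 z e (W x).
by move/negP; rewrite -ltNge => /ltW xz; rewrite ramp_eq0.
Qed.

(** The indicator of [`]-oo, z]] lies between the ramps that end and that
    start at [z], and shifting [z] by [e] changes the normal distribution
    function by at most [e]. *)
Lemma kolmogorov_smoothing (e b : R) : 0 < e ->
  (forall z, `|\int[P]_w ramp z e (W w) - gaussian_mean (ramp z e)| <= b) ->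
  forall z, `|fine (P [set w | W w <= z]) - Phi z| <= b + e.
Proof.
move=> e0 Hb z.
have zeE : z - e + e = z by rewrite subrK.
have := cdf_ramp z e0; have := cdf_ramp (z - e) e0.
have := le_gaussian_mean_ramp z e0; have := le_gaussian_mean_ramp (z - e) e0.
have := Hb z; have := Hb (z - e); rewrite !ler_norml zeE.
have : Phi (z + e) - Phi z <= z + e - z by apply: std_normal_cdf_lipschitz; lra.
have : Phi z - Phi (z - e) <= z - (z - e).
  by apply: std_normal_cdf_lipschitz; lra.
lra.
Qed.

End smoothing.

(** * The zero bias coupling bound *)

Section zero_bias_bound.
Context {R : realType}.
Local Notation phi := (@normal_pdf R 0 1).

Lemma lipschitz_locally_abs_continuous (f : R -> R) (L : R) : 0 < L ->
  (forall x y, `|f y - f x| <= L * `|y - x|) -> locally_abs_continuous f.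
Proof.
move=> L0 fL a b e e0; exists (e / L); first by rewrite divr_gt0.
move=> n x y xy _ sum_lt.
apply: (@le_lt_trans _ _ (\sum_(i < n) L * (y i - x i))).
  apply: ler_sum => i _; have [_ xyi _] := xy i.
  by rewrite -(ger0_norm (_ : 0 <= y i - x i)) ?subr_ge0.
by rewrite -mulr_sumr mulrC -ltr_pdivlMr.
Qed.

Lemma lipschitz_of_derive (f f' : R -> R) (L : R) :
  (forall x : R, is_derive x 1 f (f' x)) -> (forall x, `|f' x| <= L) ->
  forall x y, `|f y - f x| <= L * `|y - x|.
Proof.
move=> df f'L.
suff H x y : x <= y -> `|f y - f x| <= L * `|y - x|.
  move=> x y; have [|/ltW] := leP x y; first exact: H.
  by move=> /H; rewrite distrC [`|x - y|]distrC.
move=> xy.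
have [c _ ->] : exists2 c, c \in `[x, y]%R & f y - f x = f' c * (y - x).
  apply: (@MVT_segment R f f' x y xy).
  by apply: derivable_within_continuous => t _; case: (df t).
by rewrite normrM ler_wpM2r.
Qed.

Definition stein_const : R := 1 + (phi 1)^-1.

Lemma stein_const_gt0 : 0 < stein_const.
Proof. by rewrite addr_gt0// invr_gt0 std_normal_pdf_gt0. Qed.

Context d {T : measurableType d} (P : probability T R) (W Wstar : T -> R).
Hypotheses (mW : measurable_fun [set: T] W)
  (mWstar : measurable_fun [set: T] Wstar)
  (VW : 'V_P[W] = 1%E)
  (zbW : zero_bias P W Wstar).

(** The zero bias identity turns [E h(W) - E h(Z) = E(f'(W) - W f(W))] into
    [E(f'(W) - f'(Wstar))]. Rewriting [f'] by the Stein equation costs the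
    increment of [x * f x], which is controlled because [f] is bounded and
    Lipschitz, and leaves the increment of [h]. *)
Lemma zero_bias_stein_bound (h : R -> R) :
  continuous h -> (forall x, 0 <= h x <= 1) ->
  (`|\int[P]_w h (W w) - gaussian_mean h|%:E <=
   \int[P]_w (stein_const * `|Wstar w - W w| + 2 * `|(Wstar w - W w) * W w| +
              `|h (Wstar w) - h (W w)|)%:E)%E.
Proof.
move=> ch h01.
pose f := stein_sol h; pose f' (x : R) : R := x * f x + (h x - gaussian_mean h).
have df (x : R) : is_derive x 1 f (f' x) by exact: is_derive_stein_sol.
have fc (x : R) : `|f x| <= stein_const by exact: stein_sol_le.
have xf1 (x : R) : `|x * f x| <= 1 by exact: stein_sol_mul_le1.
have f'2 (x : R) : `|f' x| <= 2.
  have /andP[? ?] := h01 x; have /andP[? ?] := gaussian_mean01 ch h01.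
  by have := xf1 x; rewrite /f' !ler_norml; lra.
have f_lip := lipschitz_of_derive df f'2.
have mh : measurable_fun [set: R] h by exact: continuous_measurable_fun.
have mf : measurable_fun [set: R] f.
  apply: continuous_measurable_fun => x.
  by apply/differentiable_continuous/derivable1_diffP; case: (df x).
have mf' : measurable_fun [set: R] f'.
  apply: measurable_funD; first exact: measurable_funM.
  exact: measurable_funB.
have iWf : P.-integrable [set: T] (EFin \o (fun w => W w * f (W w))).
  apply: (@integrable_of_bounded _ _ _ _ 1) => //.
  by apply: measurable_funM => //; exact: measurableT_comp mW.
have if'Ws : P.-integrable [set: T] (EFin \o (fun w => f' (Wstar w))).
  apply: (@integrable_of_bounded _ _ _ _ 2) => //.
  exact: measurableT_comp mWstar.
have if'W : P.-integrable [set: T] (EFin \o (fun w => f' (W w))).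
  apply: (@integrable_of_bounded _ _ _ _ 2) => //.
  exact: measurableT_comp mW.
have ihW : P.-integrable [set: T] (EFin \o (fun w => h (W w))).
  apply: (@integrable_of_bounded _ _ _ _ 1); first exact: measurableT_comp mW.
  by move=> x; have /andP[? ?] := h01 (W x); rewrite ger0_norm.
have zb : \int[P]_w (W w * f (W w)) = \int[P]_w f' (Wstar w).
  have f_lac := lipschitz_locally_abs_continuous (ltr0Sn R 1) f_lip.
  have := zbW f_lac mf' _ iWf if'Ws.
  rewrite VW mul1e !unlock /Rintegral => -> //.
  exact: aeW.
have -> : \int[P]_w h (W w) - gaussian_mean h =
    \int[P]_w (f' (W w) - f' (Wstar w)).
  rewrite RintegralB// -zb -RintegralB//.
  have -> : (fun w => f' (W w) - W w * f (W w)) =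
            (fun w => h (W w) - gaussian_mean h).
    by apply/funext => w; rewrite /f'; ring.
  rewrite RintegralB//; last exact: finite_measure_integrable_cst.
  have PT : fine (P [set: T]) = 1 by rewrite probability_setT.
  by rewrite Rintegral_cst// PT mulr1.
have idf : P.-integrable [set: T] (EFin \o (fun w => f' (W w) - f' (Wstar w))).
  exact: (integrableB measurableT if'W if'Ws).
rewrite (EFin_normr_Rintegral measurableT idf).
have mD : measurable_fun [set: T] (fun w => Wstar w - W w).
  exact: measurable_funB.
have mhD : measurable_fun [set: T] (fun w => h (Wstar w) - h (W w)).
  by apply: measurable_funB; exact: measurableT_comp.
apply: le_trans (le_abse_integral _ measurableT (measurable_int _ idf)) _.
apply: ge0_le_integral => //.
- apply: measurableT_comp => //; exact: measurable_int idf.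
- apply/measurable_EFinP; apply: measurable_funD; last exact: measurableT_comp.
  apply: measurable_funD; apply: measurable_funM => //.
    exact: measurableT_comp.
  by apply: measurableT_comp => //; exact: measurable_funM.
move=> w _; rewrite lee_fin distrC.
have -> : f' (Wstar w) - f' (W w) = (Wstar w - W w) * f (Wstar w) +
  W w * (f (Wstar w) - f (W w)) + (h (Wstar w) - h (W w)) by rewrite /f'; ring.
apply: le_trans (ler_normD _ _) _; rewrite lerD2r.
apply: le_trans (ler_normD _ _) _; apply: lerD.
  by rewrite normrM mulrC ler_wpM2r.
rewrite normrM [`|_ * W w|]normrM mulrA mulrC.
by rewrite ler_wpM2r.
Qed.

End zero_bias_bound.

(** * Conditioning on the location of a window *)

Section cells.
Context d {T : measurableType d} {R : realType}.

Definition cell (q : T -> R) (eta : R) (n : nat) : set T :=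
  q @^-1` `[n%:R * eta, n.+1%:R * eta[.

Lemma cellP (q : T -> R) (eta : R) n w : cell q eta n w <->
  n%:R * eta <= q w < n%:R * eta + eta.
Proof. by rewrite /cell /= in_itv/= -natr1 mulrDl mul1r. Qed.

Lemma le_integral_cells (mu : {measure set T -> \bar R}) (H : set T)
    (q : T -> R) (eta : R) (f g : T -> \bar R) :
    measurable H -> measurable_fun [set: T] q -> (forall w, 0 <= q w) ->
    0 < eta -> measurable_fun [set: T] f -> measurable_fun [set: T] g ->
    (forall w, 0 <= f w)%E -> (forall w, 0 <= g w)%E ->
    (forall n, \int[mu]_(w in H `&` cell q eta n) f w <=
               \int[mu]_(w in H `&` cell q eta n) g w)%E ->
  (\int[mu]_(w in H) f w <= \int[mu]_(w in H) g w)%E.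
Proof.
move=> mH mq q0 eta0 mf mg f0 g0 fg.
have mC n : measurable (H `&` cell q eta n).
  apply: measurableI => //; rewrite -[cell _ _ _]setTI; exact: mq.
have HE : H = \bigcup_n (H `&` cell q eta n).
  apply/seteqP; split=> [w Hw|w [n _ []]//].
  exists (Num.truncn (q w / eta)) => //; split=> //; apply/cellP.
  have /andP[h1 h2] := truncn_itv (divr_ge0 (q0 w) (ltW eta0)).
  rewrite -ler_pdivlMr// h1/= -[X in _ + X]mul1r -mulrDl natr1.
  by rewrite -ltr_pdivrMr.
have tC : trivIset setT (fun n => H `&` cell q eta n).
  apply/trivIsetP => i j _ _ ij; apply/seteqP; split=> // w [[_ +] [_ +]].
  have key m n : (m < n)%N -> cell q eta m w -> cell q eta n w -> False.
    move=> mn /cellP/andP[_ h1] /cellP/andP[h2 _].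
    have : m.+1%:R * eta <= n%:R * eta by rewrite ler_pM2r// ler_nat.
    by rewrite -natr1 mulrDl mul1r; lra.
  by case: ltngtP ij => // ij _ ? ?; [apply: (key i j)|apply: (key j i)].
rewrite HE !ge0_integral_bigcup//; last 2 first.
- exact: measurable_funTS.
- exact: measurable_funTS.
by apply: lee_nneseries => // n _ _; exact: integral_ge0.
Qed.

End cells.

Section conditional_window.
Context d {T : measurableType d} {R : realType} (P : probability T R).

Lemma sub_sigma_algebraI (G : set_system T) A B :
  is_sub_sigma_algebra G -> G A -> G B -> G (A `&` B).
Proof.
move=> [sG _]; rewrite -(sigma_algebra_id sG) => GA GB.
exact: (@measurableI _ (g_sigma_algebraType G)).
Qed.

Lemma measurable_wrt_measurable (G : set_system T) d' (T' : measurableType d')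
    (f : T -> T') :
  is_sub_sigma_algebra G -> measurable_wrt G f -> measurable_fun [set: T] f.
Proof. by move=> [_ Gm] Gf _ B mB; rewrite setTI; apply: Gm; exact: Gf. Qed.

Lemma measurable_wrtP (G : set_system T) d' (T' : measurableType d')
    (f : T -> T') : is_sub_sigma_algebra G ->
  measurable_wrt G f <->
  measurable_fun [set: g_sigma_algebraType G] (f : g_sigma_algebraType G -> T').
Proof.
move=> [sG _]; split=> [Gf _ B mB|mf B mB].
  by rewrite setTI; apply: sub_gen_smallest; exact: Gf.
by have := mf measurableT B mB; rewrite setTI /measurable/= sigma_algebra_id.
Qed.

Lemma measurable_window (X Q : T -> R) (a b : R) :
    measurable_fun [set: T] X -> measurable_fun [set: T] Q ->
  measurable [set w | a - Q w <= X w <= b + Q w].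
Proof.
move=> mX mQ.
have -> : [set w | a - Q w <= X w <= b + Q w] =
    (fun w => X w - a + Q w) @^-1` `[0, +oo[ `&`
    (fun w => b + Q w - X w) @^-1` `[0, +oo[.
  apply/seteqP; split=> w; rewrite /= !in_itv/= !andbT.
    by move=> /andP[? ?]; split; lra.
  by move=> [? ?]; apply/andP; split; lra.
apply: measurableI; rewrite -[_ @^-1` _]setTI.
  have mXQ : measurable_fun [set: T] (fun w => X w - a + Q w).
    by apply: measurable_funD => //; exact: measurable_funB.
  exact: mXQ.
have mQX : measurable_fun [set: T] (fun w => b + Q w - X w).
  by apply: measurable_funB => //; exact: measurable_funD.
exact: mQX.
Qed.

Variables (G : set_system T) (V : T -> R) (k : T -> probability R R).
Hypotheses (hG : is_sub_sigma_algebra G) (mV : measurable_fun [set: T] V)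
  (hk : is_cond_distribution P G V k).

(** Were the window fixed and [g] the indicator of an event of [G], this
    would be the defining property of the conditional distribution [k]. Both
    are only [G]-measurable, so [H] is cut into countably many events of [G]
    on which [Q] varies by less than [e] and [g] by less than [eta]: on each
    of them the window is contained in a fixed interval of length at most
    [3 * e + 2 * Q w]. Rounding [g] up costs [eta] times a probability,
    whence the single additive term [eta]. *)
Lemma le_integral_window (H : set T) (g Q : T -> R) (A beta z e eta : R) :
    G H -> measurable_wrt G g -> measurable_wrt G Q ->
    (forall w, 0 <= g w) -> (forall w, 0 <= Q w) ->
    0 <= A -> 0 <= beta -> 0 < e -> 0 < eta ->
    {ae P, forall w, H w -> forall a b : R, a <= b ->
       (k w `]a, b]%classic <= (A * (b - a) + beta)%:E)%E} ->
  (\int[P]_(w in H)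
     (g w * \1_[set w | (z - Q w <= V w <= z + e + Q w)%R] w)%:E <=
   \int[P]_(w in H) (g w * (A * (3 * e + 2 * Q w) + beta) + eta)%:E)%E.
Proof.
move=> GH Gg GQ g0 Q0 A0 beta0 e0 eta0 kH.
have mG S : G S -> measurable S by move: hG => [_]; apply.
have mg := measurable_wrt_measurable hG Gg.
have mQ := measurable_wrt_measurable hG GQ.
set S := [set w | _].
have mS : measurable S by exact: measurable_window.
have mf : measurable_fun [set: T] (fun w => (g w * \1_S w)%:E).
  apply/measurable_EFinP; apply: measurable_funM => //.
have mh : measurable_fun [set: T]
    (fun w => (g w * (A * (3 * e + 2 * Q w) + beta) + eta)%:E).
  apply/measurable_EFinP; apply: measurable_funD => //.
  apply: measurable_funM => //; apply: measurable_funD => //.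
  apply: measurable_funM => //; apply: measurable_funD => //.
  by apply: measurable_funM.
have B0 w : 0 <= A * (3 * e + 2 * Q w) + beta.
  by rewrite addr_ge0// mulr_ge0// addr_ge0// mulr_ge0// ltW.
have f0 w : (0 <= (g w * \1_S w)%:E)%E by rewrite lee_fin mulr_ge0.
have h0 w : (0 <= (g w * (A * (3 * e + 2 * Q w) + beta) + eta)%:E)%E.
  by rewrite lee_fin; apply: addr_ge0; [exact: mulr_ge0|exact: ltW].
apply: (le_integral_cells (q := Q) (eta := e)) => // [|j]; first exact: mG.
have GC q c n : measurable_wrt G q -> G (cell q c n) by apply.
have GHj : G (H `&` cell Q e j) by apply: sub_sigma_algebraI => //; exact: GC.
apply: (le_integral_cells (q := g) (eta := eta)) => // [|i]; first exact: mG.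
set C := _ `&` _.
have GC' : G C by apply: sub_sigma_algebraI => //; exact: GC.
have mC : measurable C by exact: mG.
(* The window on this cell, with [Q] rounded up to the next multiple of [e]. *)
pose a := z - j.+1%:R * e; pose b := z + e + j.+1%:R * e.
have ab : a <= b.
  have : 0 <= j.+1%:R * e by rewrite mulr_ge0// ltW.
  by rewrite /a /b; lra.
have [Gk kE] := hk (measurable_itv `]a, b]).
have mVab : measurable (V @^-1` `]a, b]).
  by rewrite -[_ @^-1` _]setTI; exact: mV.
have i0 : 0 <= i.+1%:R * eta by rewrite mulr_ge0// ltW.
apply: (@le_trans _ _
  (\int[P]_(w in C) (i.+1%:R * eta * \1_(V @^-1` `]a, b]) w)%:E)%E).
  apply: ge0_le_integral => //.
  - exact: measurable_funTS.
  - by apply/measurable_EFinP; apply: measurable_funM.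
  move=> w [[_ /cellP Qw] /cellP gw]; rewrite lee_fin.
  apply: ler_pM => //.
    by rewrite -natr1 mulrDl mul1r; case/andP: gw => _ /ltW.
  rewrite !indicE; case: (boolP (w \in S)) => //.
  rewrite in_setE/= => /andP[h1 h2].
  rewrite mem_set// /a /b /= in_itv/= -natr1 mulrDl mul1r.
  by case/andP: Qw => _ Qw; apply/andP; split; lra.
have -> : (\int[P]_(w in C) (i.+1%:R * eta * \1_(V @^-1` `]a, b]) w)%:E =
    (i.+1%:R * eta)%:E * \int[P]_(w in C) (\1_(V @^-1` `]a, b]) w)%:E)%E.
  rewrite -ge0_integralZl_EFin//.
  by apply/measurable_EFinP; exact: measurable_funTS.
rewrite integral_indic// [_ @^-1` _ `&` _]setIC.
rewrite [X in (_ * X)%E](_ : _ =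
  \int[P]_(w in C) k w `]a, b]%classic)%E; last first.
  exact/esym/kE.
have mk : measurable_fun [set: T] (fun w => k w `]a, b]%classic).
  exact: measurable_wrt_measurable Gk.
rewrite -ge0_integralZl_EFin//; last exact: measurable_funTS.
apply: ae_ge0_le_integral => //.
- by move=> w _; rewrite mule_ge0.
- apply: measurable_funTS; exact: emeasurable_funM.
- exact: measurable_funTS.
apply: filterS kH => w kw [[Hw /cellP Qw] /cellP gw].
have := kw Hw _ _ ab.
have : (k w `]a, b]%classic <= 1%:E)%E by exact: probability_le1.
have : (0 <= k w `]a, b]%classic)%E by exact: measure_ge0.
case: (k w _) => // t; rewrite -EFinM !lee_fin => t0 t1 tAb.
have gt : i%:R * eta * t <= g w * (A * (3 * e + 2 * Q w) + beta).
  have /andP[gw1 gw2] := gw; have /andP[Qw1 Qw2] := Qw.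
  apply: ler_pM => //; first by rewrite mulr_ge0// ltW.
  apply: le_trans tAb _; rewrite lerD2r ler_wpM2l//.
  by rewrite /a /b -natr1 mulrDl mul1r; lra.
rewrite -natr1 mulrDl mul1r mulrDl; apply: lerD => //.
by rewrite ler_piMr// ltW.
Qed.

End conditional_window.

(** * The discrepancy at one parameter *)

Section one_step.
Context d {T : measurableType d} {R : realType} (P : probability T R).

Lemma le_integral_addl (c a b : R) (f g : T -> R) :
    measurable_fun [set: T] f -> measurable_fun [set: T] g -> 0 <= c ->
    (forall w, 0 <= f w) -> (forall w, 0 <= g w) ->
    (\int[P]_w (f w)%:E <= a%:E)%E -> (\int[P]_w (g w)%:E <= b%:E)%E ->
  (\int[P]_w (c * f w + g w)%:E <= (c * a + b)%:E)%E.
Proof.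
move=> mf mg c0 f0 g0 fa gb.
under eq_integral do rewrite EFinD EFinM.
rewrite ge0_integralD//=; last 4 first.
- by move=> w _; rewrite -EFinM lee_fin mulr_ge0.
- by apply/measurable_EFinP; exact: measurable_funM.
- by move=> w _; rewrite lee_fin.
- exact/measurable_EFinP.
rewrite ge0_integralZl_EFin//=; last 2 first.
- by move=> w _; rewrite lee_fin.
- exact/measurable_EFinP.
by rewrite EFinD EFinM; apply: leeD => //; apply: lee_wpmul2l.
Qed.

Lemma le_integral_cst (c : R) : (\int[P]_w c%:E <= c%:E)%E.
Proof. by rewrite integral_cst//= probability_setT mule1. Qed.

Variables (X V Wstar Dbar Bbar : T -> R) (m s : R).
Let W w := (X w - m) / s.
Hypotheses (s0 : 0 < s) (mX : measurable_fun [set: T] X)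
  (mV : measurable_fun [set: T] V) (mWstar : measurable_fun [set: T] Wstar)
  (VW : 'V_P[W] = 1%E) (zbW : zero_bias P W Wstar).
Variables (G : set_system T) (F1 F2 : set T) (k : T -> probability R R).
Hypotheses (hG : is_sub_sigma_algebra G) (hk : is_cond_distribution P G V k)
  (GDbar : measurable_wrt G Dbar) (GBbar : measurable_wrt G Bbar)
  (Dbar0 : forall w, 0 <= Dbar w) (Bbar0 : forall w, 0 <= Bbar w)
  (mF1 : measurable F1) (GF2 : G F2)
  (DDbar : forall w, F1 w -> `|Wstar w - W w| <= Dbar w)
  (XV : forall w, F1 w -> s^-1 * `|X w - V w| <= Bbar w).
Variables (A beta a1 a2 b1 c1 : R).
Hypotheses (A0 : 0 <= A) (beta0 : 0 <= beta)
  (kF2 : {ae P, forall w, F2 w -> forall a b : R, a <= b ->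
     (k w `]a, b]%classic <= (A / s * (b - a) + beta)%:E)%E})
  (ha1 : (\int[P]_w (`|Wstar w - W w| * (1 - \1_F1 w))%:E <= a1%:E)%E)
  (ha2 : (\int[P]_w (`|Wstar w - W w| * (1 - \1_F2 w))%:E <= a2%:E)%E)
  (hb1 : (\int[P]_w (`|(Wstar w - W w) * W w| + Dbar w)%:E <= b1%:E)%E)
  (hc1 : (\int[P]_w (Dbar w * (Bbar w + Dbar w) * \1_F2 w)%:E <= c1%:E)%E).

Local Notation K := (@stein_const R).

Let mW : measurable_fun [set: T] W.
Proof. by apply: measurable_funM => //; exact: measurable_funB. Qed.

Let mF2 : measurable F2.
Proof. by case: hG => _; apply. Qed.

Let mDbar : measurable_fun [set: T] Dbar.
Proof. exact: measurable_wrt_measurable GDbar. Qed.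

Let mBbar : measurable_fun [set: T] Bbar.
Proof. exact: measurable_wrt_measurable GBbar. Qed.

Let mD : measurable_fun [set: T] (fun w => Wstar w - W w).
Proof. exact: measurable_funB. Qed.

Let m1 F : measurable F ->
  measurable_fun [set: T] (fun w => `|Wstar w - W w| * (1 - \1_F w)).
Proof.
move=> mF; apply: measurable_funM; first exact: measurableT_comp.
exact: measurable_funB.
Qed.

Let ge1 F w : 0 <= `|Wstar w - W w| * (1 - \1_F w).
Proof. by rewrite mulr_ge0// subr_ge0 indicE lern1 leq_b1. Qed.

Let mb : measurable_fun [set: T] (fun w => `|(Wstar w - W w) * W w| + Dbar w).
Proof.
apply: measurable_funD => //; apply: measurableT_comp => //.
exact: measurable_funM.
Qed.

Let mc :
  measurable_fun [set: T] (fun w => Dbar w * (Bbar w + Dbar w) * \1_F2 w).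
Proof.
apply: measurable_funM => //; apply: measurable_funM => //.
exact: measurable_funD.
Qed.

(* The window of width [e] at [z] for the standardized variable, enlarged by
   [Dbar + Bbar] and read in the unstandardized coordinate. *)
Let S z e := [set w | (s * z + m - s * (Dbar w + Bbar w) <= V w <=
                       s * z + m + s * e + s * (Dbar w + Bbar w))%R].

Let mS z e : measurable (S z e).
Proof.
by apply: measurable_window => //; apply: measurable_funM => //;
  exact: measurable_funD.
Qed.

Let mFS z e :
  measurable_fun [set: T] (fun w => Dbar w * \1_(S z e) w * \1_F2 w).
Proof. by apply: measurable_funM => //; exact: measurable_funM. Qed.

Let window_le z e : 0 < e ->
  (\int[P]_w (Dbar w * \1_(S z e) w * \1_F2 w)%:E <=
   ((3 * A * e + beta) * b1 + (2 * A * c1 + e ^+ 2))%:E)%E.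
Proof.
move=> e0.
have GQ : measurable_wrt G (fun w => s * (Dbar w + Bbar w)).
  apply/(measurable_wrtP _ hG); apply: measurable_funM => //.
  by apply: measurable_funD; apply/(measurable_wrtP _ hG).
have Q0 w : 0 <= s * (Dbar w + Bbar w) by rewrite mulr_ge0 ?addr_ge0// ltW.
have se0 : 0 < s * e by rewrite mulr_gt0.
have e20 : 0 < e ^+ 2 by rewrite exprn_gt0.
have As0 : 0 <= A / s by rewrite divr_ge0// ltW.
have Ae0 : 0 <= 3 * A * e + beta by rewrite addr_ge0// mulr_ge0 ?mulr_ge0// ltW.
have A20 : 0 <= 2 * A by rewrite mulr_ge0.
have c0 w : 0 <= Dbar w * (Bbar w + Dbar w) * \1_F2 w.
  by rewrite mulr_ge0// mulr_ge0// addr_ge0.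
have b0 w : 0 <= `|(Wstar w - W w) * W w| + Dbar w by rewrite addr_ge0.
have I1 := le_integral_addl mc (measurable_cst (e ^+ 2)) A20 c0
  (fun=> ltW e20) hc1 (le_integral_cst (e ^+ 2)).
have mI1 : measurable_fun [set: T]
    (fun w => 2 * A * (Dbar w * (Bbar w + Dbar w) * \1_F2 w) + e ^+ 2).
  by apply: measurable_funD => //; exact: measurable_funM.
have I10 w : 0 <= 2 * A * (Dbar w * (Bbar w + Dbar w) * \1_F2 w) + e ^+ 2.
  by rewrite addr_ge0 ?(ltW e20)// mulr_ge0.
have I2 := le_integral_addl mb mI1 Ae0 b0 I10 hb1 I1.
apply: le_trans I2.
(* Rounding [Dbar] up by [e ^+ 2] contributes [e] after the division by [e]. *)
have := le_integral_window hG mV hk (s * z + m) GF2 GDbar GQ Dbar0 Q0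
  As0 beta0 se0 e20 kF2.
rewrite -/(S z e) => win.
rewrite (_ : (fun w => _) =
  (fun w => (Dbar w * \1_(S z e) w)%:E) \_ F2); last first.
  apply/funext => w; rewrite patchE [\1_F2 w]indicE.
  by case: (w \in F2); rewrite ?mulr1 ?mulr0.
rewrite -integral_mkcond.
apply: le_trans win _; rewrite integral_mkcond.
apply: ge0_le_integral => //.
- move=> w _; rewrite patchE; case: ifP => // _.
  rewrite lee_fin addr_ge0 ?(ltW e20)// mulr_ge0// addr_ge0// mulr_ge0//.
  by rewrite addr_ge0// mulr_ge0// ltW.
- apply/(measurable_restrictT _ mF2)/measurable_funTS/measurable_EFinP.
  apply: measurable_funD => //; apply: measurable_funM => //.
  apply: measurable_funD => //; apply: measurable_funM => //.
  apply: measurable_funD => //; apply: measurable_funM => //.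
  by apply: measurable_funM => //; exact: measurable_funD.
- apply/measurable_EFinP; apply: measurable_funD => //.
  exact: measurable_funM.
move=> w _; rewrite patchE indicE; case: (boolP (w \in F2)) => F2w; last first.
  rewrite lee_fin addr_ge0//; first exact: mulr_ge0.
  by rewrite mulr0 mulr0 add0r ltW.
rewrite lee_fin mulr1 addrA lerD2r.
have -> : Dbar w *
    (A / s * (3 * (s * e) + 2 * (s * (Dbar w + Bbar w))) + beta) =
   (3 * A * e + beta) * Dbar w + 2 * A * (Dbar w * (Bbar w + Dbar w)).
  by field; rewrite gt_eqF.
by rewrite lerD2r ler_wpM2l// lerDr.
Qed.

(** Off [F1] or off [F2] the Lipschitz bound is used. On both, [|D| <= Dbar]
    and [|X - V| <= s * Bbar], so that if [W] is close enough to the slope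
    for the ramp to vary, then [V] is in the window [S z e]. *)
Let ramp_variation_le z e w : 0 < e ->
  `|ramp z e (Wstar w) - ramp z e (W w)| <=
  e^-1 * (`|Wstar w - W w| * (1 - \1_F1 w)) +
  (e^-1 * (`|Wstar w - W w| * (1 - \1_F2 w)) +
   e^-1 * (Dbar w * \1_(S z e) w * \1_F2 w)).
Proof.
move=> e0; rewrite -!mulrDr.
have eV0 : 0 <= e^-1 by rewrite invr_ge0 ltW.
have D0 := normr_ge0 (Wstar w - W w).
have T0 : 0 <= Dbar w * \1_(S z e) w * \1_F2 w by rewrite !mulr_ge0.
have [F1w|F1w] := boolP (w \in F1); last first.
  apply: le_trans (ramp_lipschitz z _ _ e0) _; rewrite ler_wpM2l//.
  rewrite {1}indicE (negbTE F1w) subr0 mulr1 lerDl addr_ge0//.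
have [F2w|F2w] := boolP (w \in F2); last first.
  apply: le_trans (ramp_lipschitz z _ _ e0) _; rewrite ler_wpM2l//.
  rewrite [X in _ <= _ + (_ * (1 - X) + _)]indicE (negbTE F2w) subr0 mulr1.
  by have := ge1 F1 w; lra.
apply: le_trans (ramp_variation z _ _ e0) _; rewrite ler_wpM2l//.
rewrite [\1_F1 w]indicE [\1_F2 w]indicE F1w F2w subrr !mulr0 !add0r mulr1.
rewrite in_setE in F1w.
have DD := DDbar F1w; have XVw := XV F1w.
apply: ler_pM => //.
case: (boolP (_ <= _ <= _)) => //= /andP[h1 h2].
rewrite indicE mem_set// /S /=.
have XE : X w = s * W w + m by rewrite /W; field; rewrite gt_eqF.
have : `|X w - V w| <= s * Bbar w by rewrite -ler_pdivrMl.
rewrite ler_norml => /andP[h3 h4].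
have sz : s * (z - Dbar w) <= s * W w by rewrite ler_pM2l//; lra.
have szz : s * W w <= s * (z + e + Dbar w) by rewrite ler_pM2l//; lra.
rewrite mulrBr in sz; rewrite !mulrDr in szz *.
by apply/andP; split; lra.
Qed.

(** The whole Stein argument on a single probability space. The numbers [A]
    and [beta] describe how concentrated the conditional law of [V] may be on
    [F2]: [A] compares its scale with that of [X], while [beta] carries the
    discrepancy from normality of that conditional law, to be fed back by the
    contraction argument. It enters multiplied by [e^-1 * b1], which is small
    for [e] a large multiple of [b1]. *)
Lemma one_step e z : 0 < e ->
  `|fine (P [set w | W w <= z]) - std_normal_cdf z| <=
  (K + 2) * b1 + ((K + e^-1) * a1 + (e^-1 * a2 +
  e^-1 * ((3 * A * e + beta) * b1 + (2 * A * c1 + e ^+ 2)))) + e.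
Proof.
move=> e0; apply: (kolmogorov_smoothing mW e0) => {}z.
rewrite -lee_fin.
apply: le_trans (zero_bias_stein_bound mW mWstar VW zbW
  (@continuous_ramp R z e) (ramp01 z e)) _.
have eV0 : 0 <= e^-1 by rewrite invr_ge0 ltW.
have K0 := ltW (@stein_const_gt0 R).
have Ke0 : 0 <= K + e^-1 by rewrite addr_ge0.
have K20 : 0 <= K + 2 by rewrite addr_ge0.
have b0 w : 0 <= `|(Wstar w - W w) * W w| + Dbar w by rewrite addr_ge0.
have S0 w : 0 <= Dbar w * \1_(S z e) w * \1_F2 w by rewrite !mulr_ge0.
have J1 : (\int[P]_w (e^-1 * (Dbar w * \1_(S z e) w * \1_F2 w))%:E <=
    (e^-1 * ((3 * A * e + beta) * b1 + (2 * A * c1 + e ^+ 2)))%:E)%E.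
  have := le_integral_addl (mFS z e) (measurable_cst (0 : R)) eV0 S0
    (fun=> lexx 0) (window_le z e0) (le_integral_cst 0).
  by rewrite addr0; under eq_integral do rewrite addr0.
have mJ1 : measurable_fun [set: T]
    (fun w => e^-1 * (Dbar w * \1_(S z e) w * \1_F2 w)).
  exact: measurable_funM.
have J10 w : 0 <= e^-1 * (Dbar w * \1_(S z e) w * \1_F2 w) by rewrite mulr_ge0.
have J2 := le_integral_addl (m1 mF2) mJ1 eV0 (ge1 F2) J10 ha2 J1.
have mJ2 :=
  measurable_funD (measurable_funM (measurable_cst e^-1) (m1 mF2)) mJ1.
have J20 w := addr_ge0 (mulr_ge0 eV0 (ge1 F2 w)) (J10 w).
have J3 := le_integral_addl (m1 mF1) mJ2 Ke0 (ge1 F1) J20 ha1 J2.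
have mJ3 := measurable_funD
  (measurable_funM (measurable_cst (K + e^-1)) (m1 mF1)) mJ2.
have J30 w := addr_ge0 (mulr_ge0 Ke0 (ge1 F1 w)) (J20 w).
have J4 := le_integral_addl mb mJ3 K20 b0 J30 hb1 J3.
apply: le_trans J4; apply: ge0_le_integral => //.
- by move=> w _; rewrite lee_fin addr_ge0// addr_ge0// mulr_ge0.
- apply/measurable_EFinP; apply: measurable_funD; last first.
    apply: measurableT_comp => //; apply: measurable_funB.
      apply: measurableT_comp mWstar.
      by apply: continuous_measurable_fun; exact: continuous_ramp.
    apply: measurableT_comp mW.
    by apply: continuous_measurable_fun; exact: continuous_ramp.
  apply: measurable_funD; apply: measurable_funM => //.
    exact: measurableT_comp.
  by apply: measurableT_comp => //; exact: measurable_funM.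
- apply/measurable_EFinP; apply: measurable_funD mJ3.
  exact: measurable_funM.
move=> w _; rewrite lee_fin.
have := ramp_variation_le z w e0.
have D_le : `|Wstar w - W w| <= Dbar w + `|Wstar w - W w| * (1 - \1_F1 w).
  have [F1w|F1w] := boolP (w \in F1); last first.
    by rewrite indicE (negbTE F1w) subr0 mulr1 lerDr.
  rewrite indicE F1w subrr mulr0 addr0; apply: DDbar.
  by rewrite in_setE in F1w.
have KD := ler_wpM2l K0 D_le.
have KDW := mulr_ge0 K0 (normr_ge0 ((Wstar w - W w) * W w)).
have Db := Dbar0 w.
rewrite /= in KD KDW *.
lra.
Qed.

End one_step.

(** * Standardization and anti-concentration *)

Section standardization.
Context d {T : measurableType d} {R : realType} (P : probability T R).

Lemma variance_standardize (X : T -> R) :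
    measurable_fun [set: T] X -> P.-integrable [set: T] (EFin \o X) ->
    ('V_P[X] < +oo)%E -> 0 < fine 'V_P[X]%E ->
  'V_P[fun w => (X w - fine 'E_P[X]) / Num.sqrt (fine 'V_P[X])] = 1%E.
Proof.
move=> mX iX Voo V0; set m := fine _; set s := Num.sqrt _.
have s0 : 0 < s by rewrite sqrtr_gt0.
have Efin : 'E_P[X]%E = m%:E.
  by rewrite /m fineK// expectation_fin_num//; exact/Lfun1_integrable.
have EW : 'E_P[fun w => ((X w - m) / s)%R]%E = 0%E.
  have ic : P.-integrable [set: T] (EFin \o cst m).
    exact: finite_measure_integrable_cst.
  have iXm : P.-integrable [set: T] (EFin \o (fun w => X w - m)).
    exact: (integrableB measurableT iX ic).
  rewrite unlock.
  under eq_integral do rewrite EFinM.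
  rewrite integralZr//= integralB_EFin//=.
  move: Efin; rewrite unlock => ->.
  by rewrite integral_cst//= probability_setT mule1 subee// mul0e.
have mXm : measurable_fun [set: T] (fun w => X w - m) by exact: measurable_funB.
have Vfin : 'V_P[X]%E = (s ^+ 2)%:E.
  rewrite sqr_sqrtr ?ltW// fineK// fin_numE -ltey Voo andbT.
  by apply: contraTneq V0 => ->; rewrite /= ltxx.
have VX : (\int[P]_w ((X w - m) ^+ 2)%:E = (s ^+ 2)%:E)%E.
  rewrite -Vfin /variance covariance.unlock -/m unlock.
  by apply: eq_integral => w _; rewrite expr2.
rewrite /variance covariance.unlock EW unlock.
transitivity (\int[P]_w ((s ^- 2)%:E * ((X w - m) ^+ 2)%:E))%E.
  apply: eq_integral => w _; rewrite -EFinM; congr EFin.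
  by rewrite !fctE /= subr0; field; rewrite gt_eqF.
rewrite ge0_integralZl_EFin//=.
- by rewrite VX -EFinM mulVf// expf_neq0// gt_eqF.
- by move=> w _; rewrite lee_fin sqr_ge0.
- by apply/measurable_EFinP; exact: measurable_funX.
- by rewrite invr_ge0 sqr_ge0.
Qed.

(** The normal density is at most 1, so the normal mass of an interval is at
    most its length; each end point costs one discrepancy. *)
Lemma le_prob_itv (X : T -> R) (m s delta a b : R) :
    measurable_fun [set: T] X -> 0 < s -> a <= b ->
    (forall z, `|fine (P [set w | (X w - m) / s <= z]) - std_normal_cdf z|
               <= delta) ->
  (P (X @^-1` `]a, b]) <= ((b - a) / s + 2 * delta)%:E)%E.
Proof.
move=> mX s0 ab Hd.
have mI (i : interval R) : measurable (X @^-1` [set` i]).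
  by rewrite -[_ @^-1` _]setTI; exact: mX.
pose a' := (a - m) / s; pose b' := (b - m) / s.
have SE c : [set w | (X w - m) / s <= (c - m) / s] = X @^-1` `]-oo, c].
  by apply/seteqP; split=> w; rewrite /= in_itv/= ler_pM2r ?invr_gt0// lerD2r.
have := Hd a'; have := Hd b'; rewrite /a' /b' !SE.
have -> : X @^-1` `]-oo, b] = X @^-1` `]-oo, a] `|` X @^-1` `]a, b].
  by rewrite -preimage_setU -itv_bndbnd_setU//= bnd_simp.
rewrite measureU//; last first.
  rewrite -preimage_setI -[RHS](preimage_set0 X); congr preimage.
  apply/seteqP; split=> // x [] /=; rewrite !in_itv/= => xa /andP[].
  by rewrite ltNge xa.
have fa : P (X @^-1` `]-oo, a]) \is a fin_num by exact: fin_num_measure.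
have fab : P (X @^-1` `]a, b]) \is a fin_num by exact: fin_num_measure.
rewrite fineD// -(fineK fab) /= lee_fin.
have : std_normal_cdf ((b - m) / s) - std_normal_cdf ((a - m) / s) <=
       (b - m) / s - (a - m) / s.
  by apply: std_normal_cdf_lipschitz; rewrite ler_pM2r ?invr_gt0// lerD2r.
have -> : (b - m) / s - (a - m) / s = (b - a) / s by ring.
rewrite !ler_norml; lra.
Qed.

End standardization.

Section uniform_bounds.
Context {R : realType}.

Lemma ereal_sup_lty_bound (I : Type) (A : set I) (f : I -> \bar R) :
  (ereal_sup [set f i | i in A] < +oo)%E ->
  exists2 C : R, 0 <= C & forall i, A i -> (f i <= C%:E)%E.
Proof.
move=> foo; pose M := ereal_sup [set f i | i in A].
have fM i : A i -> (f i <= M)%E by move=> Ai; apply: ereal_sup_ubound; exists i.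
rewrite -/M in foo; case: M foo fM => // [r _ fr|_ fr].
  exists `|r| => // i /fr fir; apply: le_trans fir _.
  by rewrite lee_fin ler_norm.
by exists 0 => // i /fr fi; exact: le_trans fi (leNye _).
Qed.

Lemma ess_sup_on_ae d (T : measurableType d) (P : probability T R) (A : set T)
    (f : T -> R) (C : R) : (ess_sup_on P A f <= C%:E)%E ->
  {ae P, forall w, A w -> f w <= C}.
Proof.
move=> /ess_supP; apply: filterS => w + Aw.
by rewrite mem_set// lee_fin.
Qed.

End uniform_bounds.

(** * The contraction argument *)

Section arithmetic.
Context {R : realType}.

(** The bound of [one_step] with every expectation replaced by its order in [r]
    and with [e = L / r], multiplied by [m]. The condition on [L] makes the
    coefficient of [S] at most 1/2; in the other terms [m / r <= 1]. *)
Lemma one_step_arith (K Ca Cb Cd Ce A Kb S L r m rbar Delta : R) :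
    0 <= K -> 0 <= Ca -> 0 <= Cb -> 0 <= Cd -> 0 <= Ce -> 0 <= A ->
    0 <= Kb -> 0 <= S -> 4 * Kb * Cb < L -> 0 < rbar -> rbar < r ->
    0 < m -> m <= r ->
    Delta <= (K + 2) * (Cb / r) + ((K + (L / r)^-1) * (Ca / r ^+ 2) +
      ((L / r)^-1 * (Cd / r ^+ 2) + (L / r)^-1 *
      ((3 * A * (L / r) + (2 * (Kb * S / m) + Kb * rbar / r)) * (Cb / r) +
       (2 * A * (Ce / r ^+ 2) + (L / r) ^+ 2)))) + L / r ->
  m * Delta <= (K + 2) * Cb + K * Ca / rbar + (Ca + Cd) / L + 3 * A * Cb +
    Kb * rbar * Cb / L + 2 * A * Ce / L + 2 * L + S / 2.
Proof.
move=> K0 Ca0 Cb0 Cd0 Ce0 A0 Kb0 S0 KL rb0 rbr m0 mr HD.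
have L0 : 0 < L by apply: le_lt_trans KL; rewrite !mulr_ge0.
have r0 : 0 < r by exact: lt_trans rbr.
pose q := m / r.
have q0 : 0 <= q by rewrite divr_ge0// ltW.
have q1 : q <= 1 by rewrite ler_pdivrMr// mul1r.
have mD : m * Delta <= q * ((K + 2) * Cb + K * Ca / r + (Ca + Cd) / L +
    3 * A * Cb + Kb * rbar * Cb / L + 2 * A * Ce / L + 2 * L) +
    2 * Kb * Cb / L * S.
  apply: le_trans (ler_wpM2l (ltW m0) HD) _.
  rewrite le_eqVlt; apply/orP; left; apply/eqP; rewrite /q.
  by field; rewrite !gt_eqF.
have LV0 : 0 <= L^-1 by rewrite invr_ge0 ltW.
have SL : 2 * Kb * Cb / L * S <= S / 2.
  rewrite mulrC; apply: ler_wpM2l => //.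
  by rewrite ler_pdivrMr//; lra.
have rV : K * Ca / r <= K * Ca / rbar.
  by rewrite ler_wpM2l ?mulr_ge0// lef_pV2 ?posrE// ltW.
apply: le_trans mD _; apply: lerD SL.
set Z := (X in q * X).
apply: (@le_trans _ _ Z).
  rewrite ler_piMl//.
  have ? : 0 <= K * Ca / r by rewrite !mulr_ge0// invr_ge0 ltW.
  have ? : 0 <= (Ca + Cd) / L by rewrite mulr_ge0// addr_ge0.
  have ? : 0 <= 3 * A * Cb by rewrite !mulr_ge0.
  have ? : 0 <= (K + 2) * Cb by rewrite mulr_ge0// addr_ge0.
  have ? : 0 <= Kb * rbar * Cb / L by rewrite !mulr_ge0// ltW.
  have ? : 0 <= 2 * A * Ce / L by rewrite !mulr_ge0.
  by rewrite /Z; do ?apply: addr_ge0 => //; lra.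
by rewrite /Z !lerD2r lerD2l.
Qed.

(** The a priori bound [B] guarantees that the supremum exists, and then
    drops out of the conclusion. *)
Lemma bounded_contraction (E : set R) (C B : R) :
    (forall x, E x -> x <= B) ->
    (forall S, 0 <= S -> (forall x, E x -> x <= S) ->
               forall x, E x -> x <= C + S / 2) ->
    (forall x, E x -> 0 <= x) ->
  forall x, E x -> x <= 2 * C.
Proof.
move=> EB Econtr E0 x Ex.
have hub : has_ubound E by exists B.
have xs : x <= sup E by exact: ub_le_sup.
have : sup E <= C + sup E / 2.
  apply: ge_sup; first by exists x.
  by apply: Econtr; [exact: le_trans (E0 _ Ex) xs | move=> y; exact: ub_le_sup].
lra.
Qed.

End arithmetic.

(** * The bound of order 1/r *)

Theorem theorem1p2 (R : realType) (d1 d2 : measure_display)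
  (Theta : measurableType d1) (Omega : measurableType d2)
  (* transition kernel from Theta to Omega *)
  (P : Theta -> probability Omega R)
  (hP : forall A : set Omega, measurable A ->
     measurable_fun [set: Theta] (fun t => P t A))
  (Y : Theta * Omega -> R)
  (hY : measurable_fun [set: Theta * Omega] Y)
  (hYmean : forall t, (P t).-integrable [set: Omega] (fun w => (Y (t, w))%:E))
  (hYvar : forall t, ('V_(P t)[fun w => Y (t, w)] < +oo)%E)
  (* (Z1) *)
  (r : Theta -> R) (hr : measurable_fun [set: Theta] r)
  (hr0 : forall t, 0 < r t)
  (rbar : R) (hrbar : 0 < rbar)
  (Theta0 := [set t : Theta | rbar < r t])
  (hZ1 : forall t, Theta0 t -> 0 < pvar P Y t)
  (* (Z2) *)
  (W := standardized P Y)
  (Wstar : Theta * Omega -> R)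
  (hWstar : measurable_fun [set: Theta * Omega] Wstar)
  (hZ2 : forall t, Theta0 t ->
     zero_bias (P t) (fun w => W (t, w)) (fun w => Wstar (t, w)))
  (* (Z3) *)
  (F : Theta -> set_system Omega)
  (hF : forall t, Theta0 t -> is_sub_sigma_algebra (F t))
  (D := fun p : Theta * Omega => Wstar p - W p)
  (Dbar : Theta * Omega -> R)
  (hDbar : measurable_fun [set: Theta * Omega] Dbar)
  (hDbar0 : forall t, Theta0 t -> forall w, 0 <= Dbar (t, w))
  (hDbarF : forall t, Theta0 t -> measurable_wrt (F t) (fun w => Dbar (t, w)))
  (F1 : Theta -> set Omega)
  (hF1 : forall t, Theta0 t -> measurable (F1 t))
  (hDDbar : forall t, Theta0 t -> forall w, F1 t w ->
     `|D (t, w)| <= Dbar (t, w))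
  (hZ3a : (ereal_sup [set (r t ^+ 2)%:E *
       'E_(P t)[fun w => (`|D (t, w)| * (1 - \1_(F1 t) w))%R]
     | t in Theta0] < +oo)%E)
  (hZ3b : (ereal_sup [set (r t)%:E *
       'E_(P t)[fun w => (`|D (t, w) * W (t, w)| + Dbar (t, w))%R]
     | t in Theta0] < +oo)%E)
  (* (Z4) *)
  (V : Theta * Omega -> R)
  (hV : measurable_fun [set: Theta * Omega] V)
  (Psi : Theta * Omega -> Theta)
  (hPsi : measurable_fun [set: Theta * Omega] Psi)
  (hPsiF : forall t, Theta0 t -> measurable_wrt (F t) (fun w => Psi (t, w)))
  (F2 : Theta -> set Omega)
  (hF2 : forall t, Theta0 t -> F t (F2 t))
  (hZ4a : forall t, Theta0 t -> exists k : Omega -> probability R R,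
     is_cond_distribution (P t) (F t) (fun w => V (t, w)) k /\
     forall w, F2 t w -> forall B : set R, measurable B ->
       k w B = P (Psi (t, w)) [set w' | B (Y (Psi (t, w), w'))])
  (hZ4b : (ereal_sup [set (r t ^+ 2)%:E *
       'E_(P t)[fun w => (`|D (t, w)| * (1 - \1_(F2 t) w))%R]
     | t in Theta0] < +oo)%E)
  (* (Z5) *)
  (Bbar : Theta * Omega -> R)
  (hBbar : measurable_fun [set: Theta * Omega] Bbar)
  (hBbar0 : forall t, Theta0 t -> forall w, 0 <= Bbar (t, w))
  (hBbarF : forall t, Theta0 t -> measurable_wrt (F t) (fun w => Bbar (t, w)))
  (hYV : forall t, Theta0 t -> forall w, F1 t w ->
     (psd P Y t)^-1 * `|Y (t, w) - V (t, w)| <= Bbar (t, w))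
  (hZ5 : (ereal_sup [set (r t ^+ 2)%:E *
       'E_(P t)[fun w => (Dbar (t, w) * (Bbar (t, w) + Dbar (t, w)) *
                         \1_(F2 t) w)%R]
     | t in Theta0] < +oo)%E)
  (* (G7) *)
  (hG7a : (ereal_sup [set ess_sup_on (P t)
       (F2 t `&` [set w | Theta0 (Psi (t, w))])
       (fun w => (psd P Y t ^+ 2 / psd P Y (Psi (t, w)) ^+ 2)%R)
     | t in Theta0] < +oo)%E)
  (hG7b : (ereal_sup [set ess_sup_on (P t) (F2 t)
       (fun w => (r t / r (Psi (t, w)))%R)
     | t in Theta0] < +oo)%E)
  (hG7c : (ereal_sup [set ess_sup_on (P t)
       (F2 t `&` [set w | Theta0 (Psi (t, w))])
       (fun w => (r (Psi (t, w)) / r t)%R)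
     | t in Theta0] < +oo)%E) :
  exists C : R, forall t : Theta,
    (ereal_sup [set `| P t [set w | (W (t, w) <= z)%R]
                       - normal_prob 0 1 `]-oo, z] |
     | z in [set: R]] <= (C / r t)%:E)%E.
Proof.
have K0 := ltW (@stein_const_gt0 R).
have [Ca Ca0 hCa] := ereal_sup_lty_bound hZ3a.
have [Cb Cb0 hCb] := ereal_sup_lty_bound hZ3b.
have [Cd Cd0 hCd] := ereal_sup_lty_bound hZ4b.
have [Ce Ce0 hCe] := ereal_sup_lty_bound hZ5.
have [Ka Ka0 hKa] := ereal_sup_lty_bound hG7a.
have [Kb' Kb'0 hKb] := ereal_sup_lty_bound hG7b.
pose A := 1 + Ka; pose Kb := 1 + Kb'.
pose L := 4 * Kb * Cb + 1.
have A0 : 0 <= A by rewrite addr_ge0.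
have Kb0 : 0 <= Kb by rewrite addr_ge0.
pose Delta t z := `|fine (P t [set w | W (t, w) <= z]) - std_normal_cdf z|.
have mY t : measurable_fun [set: Omega] (fun w => Y (t, w)).
  exact: measurable_fun_pair2.
have mV t : measurable_fun [set: Omega] (fun w => V (t, w)).
  exact: measurable_fun_pair2.
have mWs t : measurable_fun [set: Omega] (fun w => Wstar (t, w)).
  exact: measurable_fun_pair2.
have sd0 t : Theta0 t -> 0 < psd P Y t.
  by move=> /hZ1; rewrite /psd sqrtr_gt0.
have WE t : Theta0 t ->
    (fun w => W (t, w)) = (fun w => (Y (t, w) - pmean P Y t) / psd P Y t).
  by move=> /sd0 s0; apply/funext => w; rewrite /W /standardized /= s0.
have mW t : measurable_fun [set: Omega] (fun w => W (t, w)).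
  rewrite /W /standardized /=; case: (0 < psd P Y t) => //.
  by apply: measurable_funM => //; exact: measurable_funB.
have mWle t z : measurable [set w | W (t, w) <= z].
  have := mW t measurableT _ (measurable_itv `]-oo, z]).
  by rewrite setTI preimage_itvNyc.
have Delta_le1 t z : Delta t z <= 1.
  have PW0 : 0 <= fine (P t [set w | W (t, w) <= z]) by exact: fine_ge0.
  have PW1 : fine (P t [set w | W (t, w) <= z]) <= 1.
    by rewrite -lee_fin fineK ?fin_num_measure//; exact: probability_le1.
  have Z0 : 0 <= std_normal_cdf z by exact: fine_ge0.
  have Z1 : std_normal_cdf z <= 1.
    by rewrite -lee_fin fineK ?fin_num_measure//; exact: probability_le1.
  by rewrite /Delta ler_norml; lra.
pose C := (stein_const + 2) * Cb + stein_const * Ca / rbar + (Ca + Cd) / L +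
  3 * A * Cb + Kb * rbar * Cb / L + 2 * A * Ce / L + 2 * L.
have step n S : 0 < n -> 0 <= S ->
    (forall u z, Theta0 u -> Num.min (r u) n * Delta u z <= S) ->
    forall t z, Theta0 t -> Num.min (r t) n * Delta t z <= C + S / 2.
  move=> n0 S0 HS t z Tt.
  have s0 := sd0 t Tt.
  have rt0 := hr0 t.
  have mt0 : 0 < Num.min (r t) n by rewrite lt_min rt0 n0.
  have m_r : Num.min (r t) n <= r t by rewrite ge_min lexx.
  have L0 : 0 < L by rewrite /L ltr_wpDl// !mulr_ge0.
  have ediv (c : R) (x : \bar R) j : ((r t ^+ j)%:E * x <= c%:E ->
      x <= (c / r t ^+ j)%:E)%E.
    by rewrite mulrC EFinM lee_pdivlMl// exprn_gt0.
  have [k [kV kY]] := hZ4a t Tt.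
  pose beta := 2 * (Kb * S / Num.min (r t) n) + Kb * rbar / r t.
  have beta0 : 0 <= beta.
    by rewrite addr_ge0// ?mulr_ge0// ?invr_ge0 ltW.
  have kF2 : {ae P t, forall w, F2 t w -> forall a b : R, a <= b ->
     (k w `]a, b]%classic <= (A / psd P Y t * (b - a) + beta)%:E)%E}.
    have aeA := ess_sup_on_ae (hKa t Tt).
    have aeB := ess_sup_on_ae (hKb t Tt).
    apply: filterS2 aeA aeB => w wA wB F2w a b ab.
    rewrite (kY w F2w _ (measurable_itv `]a, b])).
    (* [u] is the random parameter under which [Y] is conditionally drawn. *)
    set u := Psi (t, w) in wA wB *.
    have ru0 := hr0 u.
    have rtu : r t <= Kb * r u.
      apply: (@le_trans _ _ (Kb' * r u)); first by rewrite -ler_pdivrMr// wB.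
      by rewrite ler_pM2r// /Kb lerDr.
    (* If [u] is not in [Theta0], then [r t] is bounded and 1 is of order
       1/r. *)
    have [Tu|ru] := ltP rbar (r u); last first.
      have Pu1 : (P u [set w' | `]a, b]%classic (Y (u, w'))] <= 1)%E.
        apply: probability_le1; rewrite -[X in measurable X]setTI.
        exact: (mY u measurableT _ (measurable_itv `]a, b])).
      apply: le_trans Pu1 _; rewrite lee_fin.
      have h1 : 1 <= Kb * rbar / r t.
        by rewrite ler_pdivlMr// mul1r (le_trans rtu)// ler_wpM2l.
      have h2 : 0 <= A / psd P Y t * (b - a).
        by rewrite mulr_ge0 ?subr_ge0// divr_ge0// ltW.
      have h3 : 0 <= 2 * (Kb * S / Num.min (r t) n).
        by rewrite mulr_ge0// divr_ge0 ?mulr_ge0// ltW.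
      by rewrite /beta; lra.
    have su0 := sd0 u Tu.
    have mu0 : 0 < Num.min (r u) n by rewrite lt_min ru0 n0.
    have mtu : Num.min (r t) n <= Kb * Num.min (r u) n.
      have [_|_] := leP (r u) n; rewrite ge_min; apply/orP; first by left.
      by right; rewrite ler_peMl ?lerDl// ltW.
    have HD z' : `|fine (P u
          [set w' | (Y (u, w') - pmean P Y u) / psd P Y u <= z'])
                   - std_normal_cdf z'| <= S / Num.min (r u) n.
      have -> : [set w' | (Y (u, w') - pmean P Y u) / psd P Y u <= z'] =
                [set w' | W (u, w') <= z'].
        by apply/seteqP; split=> w' /=;
          have /(congr1 (fun f => f w')) /= -> := WE u Tu.
      by rewrite ler_pdivlMr// mulrC; exact: HS.
    apply: le_trans (le_prob_itv (mY u) su0 ab HD) _; rewrite lee_fin.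
    have sA : psd P Y t / psd P Y u <= A.
      have := wA (conj F2w Tu); rewrite -expr_div_n.
      set x := _ / _ => xKa; rewrite /A.
      have x0 : 0 <= x by rewrite divr_ge0// ltW.
      nra.
    have h1 : (b - a) / psd P Y u <= A / psd P Y t * (b - a).
      rewrite mulrC ler_wpM2r ?subr_ge0// ler_pdivlMr//.
      by rewrite mulrC.
    have h2 : S / Num.min (r u) n <= Kb * S / Num.min (r t) n.
      rewrite ler_pdivrMr// mulrAC ler_pdivlMr//.
      rewrite [Kb * S]mulrC -mulrA; exact: ler_wpM2l.
    have h3 : 0 <= Kb * rbar / r t by rewrite divr_ge0 ?mulr_ge0// ltW.
    by rewrite /beta; lra.
  have VW : ('V_(P t)[fun w => ((Y (t, w) - pmean P Y t) / psd P Y t)%R] = 1)%E.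
    apply: variance_standardize => //; exact: hZ1.
  have zb : zero_bias (P t) (fun w => (Y (t, w) - pmean P Y t) / psd P Y t)
      (fun w => Wstar (t, w)).
    by rewrite -WE//; exact: hZ2.
  have wE w : (Y (t, w) - pmean P Y t) / psd P Y t = W (t, w).
    by have /(congr1 (fun f => f w)) := WE t Tt.
  have DD w : F1 t w ->
     `|Wstar (t, w) - (Y (t, w) - pmean P Y t) / psd P Y t| <= Dbar (t, w).
    by rewrite wE; exact: hDDbar.
  have Ib1 : (\int[P t]_w
      (`|(Wstar (t, w) - (Y (t, w) - pmean P Y t) / psd P Y t) *
      ((Y (t, w) - pmean P Y t) / psd P Y t)| + Dbar (t, w))%:E
      <= (Cb / r t)%:E)%E.
    under eq_integral do rewrite wE.
    have := hCb t Tt; rewrite unlock -{1}[r t]expr1 => /ediv.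
    by rewrite expr1; exact.
  have Ia1 : (\int[P t]_w
     (`|Wstar (t, w) - (Y (t, w) - pmean P Y t) / psd P Y t| *
      (1 - \1_(F1 t) w))%:E <= (Ca / r t ^+ 2)%:E)%E.
    under eq_integral do rewrite wE.
    by have := hCa t Tt; rewrite unlock => /ediv; exact.
  have Ia2 : (\int[P t]_w
     (`|Wstar (t, w) - (Y (t, w) - pmean P Y t) / psd P Y t| *
      (1 - \1_(F2 t) w))%:E <= (Cd / r t ^+ 2)%:E)%E.
    under eq_integral do rewrite wE.
    by have := hCd t Tt; rewrite unlock => /ediv; exact.
  have Ic1 : (\int[P t]_w (Dbar (t, w) * (Bbar (t, w) + Dbar (t, w)) *
      \1_(F2 t) w)%:E <= (Ce / r t ^+ 2)%:E)%E.
    by have := hCe t Tt; rewrite unlock => /ediv; exact.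
  have e0 : 0 < L / r t by rewrite divr_gt0.
  have := one_step s0 (mY t) (mV t) (mWs t) VW zb (hF t Tt) kV (hDbarF t Tt)
    (hBbarF t Tt) (hDbar0 t Tt) (hBbar0 t Tt) (hF1 t Tt) (hF2 t Tt) DD
    (hYV t Tt) A0 beta0 kF2 Ia1 Ia2 Ib1 Ic1 z e0.
  have -> : [set w | (Y (t, w) - pmean P Y t) / psd P Y t <= z] =
      [set w | W (t, w) <= z].
    by apply/seteqP; split=> w /=; rewrite wE.
  apply: one_step_arith => //.
  by rewrite /L ltrDl.
pose E n := [set x | exists t z, Theta0 t /\ x = Num.min (r t) n * Delta t z].
(* The truncation level may be chosen equal to [r t], as the bound does not
   depend on it. *)
have bound t z : Theta0 t -> r t * Delta t z <= 2 * C.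
  move=> Tt.
  apply: (@bounded_contraction _ (E (r t)) C (r t)).
  - move=> x [u [y [Tu ->]]]; rewrite -[leRHS]mulr1; apply: ler_pM => //.
    - by rewrite le_min !ltW.
    - exact: normr_ge0.
    - by rewrite ge_min lexx orbT.
  - move=> S S0 ES x [u [y [Tu ->]]].
    apply: step => // v c Tv; apply: ES; by exists v, c.
  - by move=> x [u [y [Tu ->]]]; rewrite mulr_ge0 ?normr_ge0// le_min !ltW.
  by exists t, z; split=> //; rewrite minxx.
exists (Num.max rbar (2 * C)) => t.
apply: ge_ereal_sup => _ [z _ <-].
have -> : (`|P t [set w | (W (t, w) <= z)%R] - normal_prob 0 1 `]-oo, z]| =
    (Delta t z)%:E)%E.
  have PWfin : P t [set w | W (t, w) <= z] \is a fin_num.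
    exact: fin_num_measure.
  have Zfin : (@normal_prob R 0 1 `]-oo, z]) \is a fin_num.
    exact: fin_num_measure.
  by rewrite -(fineK PWfin) -(fineK Zfin) -EFinB abse_EFin.
rewrite lee_fin ler_pdivlMr// mulrC le_max; apply/orP.
have [rt|rt] := ltP rbar (r t); first by right; exact: bound.
by left; apply: le_trans rt; rewrite -[leRHS]mulr1 ler_wpM2l// ltW.
Qed.
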